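(* Let $t\in\mathbb{C}$ be an $8$th root of unity, let $T\in\{i,-i\}$, let $d\in\mathbb{C}$ with $d\neq0$, and put $a=d$, $c=-d^2$. Let $\rho=\rho(T,t,a,c,d):\mathcal{NB}_4\to GL(2,\mathbb{C})$ be the corresponding irreducible representation of the necklace braid group $\mathcal{NB}_4$. Then there exists a hermitian positive definite matrix $M$ such that $\rho$ is unitary relative to $M$ if and only if $|d|^2=\frac12$.
   Context: The necklace braid group $\mathcal{NB}_n$ is the group with generators $\sigma_1,\dots,\sigma_n,\tau$ and relations (indices taken modulo $n$, so $\sigma_{n+1}=\sigma_1$): $\sigma_i\sigma_{i+1}\sigma_i=\sigma_{i+1}\sigma_i\sigma_{i+1}$; $\sigma_i\sigma_j=\sigma_j\sigma_i$ whenever $i-j\not\equiv\pm1 \pmod n$; $\tau\sigma_i\tau^{-1}=\sigma_{i+1}$; $\tau^{2n}=1$. For the parameters considered, $\rho(T,t,a,c,d)$ denotes the representation of $\mathcal{NB}_n$ on $\mathbb{C}^2$ with $\tau\mapsto\begin{pmatrix}Tt&0\\0&t\end{pmatrix}$ and $\sigma_j\mapsto\begin{pmatrix}a&T^{j-1}\\ cT^{1-j}&d\end{pmatrix}$ for $1\le j\le n$ (here $n=4$). A square matrix $A$ is unitary relative to a matrix $M$ if $AMA^*=M$, where $A^*$ is the conjugate transpose of $A$. A representation $\rho$ of a group $G$ is unitary relative to $M$ if $\rho(g)$ is unitary relative to $M$ for every $g\in G$. *)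

(* Defs.v *)
From HB Require Import structures.
From mathcomp Require Import all_boot all_order all_algebra.
From mathcomp Require Import boolp reals complex ring.

Set Implicit Arguments.
Unset Strict Implicit.
Unset Printing Implicit Defensive.

Import Order.TTheory GRing.Theory Num.Theory.

Local Open Scope ring_scope.
Local Open Scope sesquilinear_scope.
Local Open Scope quotient_scope.

(* A letter (x, b) stands for the generator x if b = false and for its formal
   inverse if b = true; a word is a finite product of letters. *)
Definition word (X : choiceType) := seq (X * bool).

Definition inv_word (X : choiceType) (w : word X) : word X :=
  rev [seq (l.1, ~~ l.2) | l <- w].

(* The least congruence on words that cancels x x^-1 and x^-1 x and contains
   the relations u = v for which rel u v holds. *)
Inductive pres_cong (X : choiceType) (rel : word X -> word X -> Prop) :
    word X -> word X -> Prop :=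
| pres_refl u : pres_cong rel u u
| pres_sym u v : pres_cong rel u v -> pres_cong rel v u
| pres_trans u v w : pres_cong rel u v -> pres_cong rel v w -> pres_cong rel u w
| pres_cat u u' v v' : pres_cong rel u u' -> pres_cong rel v v' ->
    pres_cong rel (u ++ v) (u' ++ v')
| pres_cancel x b : pres_cong rel [:: (x, b); (x, ~~ b)] [::]
| pres_rel u v : rel u v -> pres_cong rel u v.

Section PresentedGroup.
Variables (X : choiceType) (rel : word X -> word X -> Prop).
Local Notation cong := (pres_cong rel).

Definition pres_eq (u v : word X) : bool := `[< cong u v >].

Fact pres_eq_refl : reflexive pres_eq.
Proof. by move=> u; apply/asboolP; exact: pres_refl. Qed.

Fact pres_eq_sym : symmetric pres_eq.
Proof. by move=> u v; apply/asboolP/asboolP; exact: pres_sym. Qed.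

Fact pres_eq_trans : transitive pres_eq.
Proof.
move=> v u w /asboolP uv /asboolP vw; apply/asboolP; exact: pres_trans vw.
Qed.

Canonical pres_equiv := EquivRel pres_eq pres_eq_refl pres_eq_sym pres_eq_trans.

Definition presented_group := {eq_quot pres_equiv}.
HB.instance Definition _ := Choice.on presented_group.

Definition pres_pi (w : word X) : presented_group := \pi_{eq_quot pres_equiv} w.
Definition pres_repr (g : presented_group) : word X := repr g.
Definition pres_gen (x : X) : presented_group := pres_pi [:: (x, false)].

Definition pres_one : presented_group := pres_pi [::].
Definition pres_mul (g h : presented_group) :=
  pres_pi (pres_repr g ++ pres_repr h).
Definition pres_inv (g : presented_group) := pres_pi (inv_word (pres_repr g)).

Lemma pres_piP u v : pres_pi u = pres_pi v <-> cong u v.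
Proof.
split=> [uv | /asboolP uv]; last by apply/eqquotP.
by apply/asboolP; move/eqquotP: uv.
Qed.

Lemma pres_reprK g : pres_pi (pres_repr g) = g.
Proof. exact: reprK. Qed.

Lemma pres_repr_pi u : cong (pres_repr (pres_pi u)) u.
Proof. by apply/pres_piP; rewrite pres_reprK. Qed.

Lemma pres_piM u v : pres_mul (pres_pi u) (pres_pi v) = pres_pi (u ++ v).
Proof. by apply/pres_piP; apply: pres_cat; exact: pres_repr_pi. Qed.

Lemma inv_wordK : involutive (@inv_word X).
Proof.
move=> w; rewrite /inv_word map_rev revK -map_comp -[RHS]map_id.
by apply: eq_map => -[x b] /=; rewrite negbK.
Qed.

Lemma inv_wordVr w : cong (w ++ inv_word w) [::].
Proof.
elim: w => [|[x b] w IHw]; first exact: pres_refl.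
have -> : ((x, b) :: w) ++ inv_word ((x, b) :: w) =
    [:: (x, b)] ++ (w ++ inv_word w) ++ [:: (x, ~~ b)].
  by rewrite /inv_word /= rev_cons -cats1 catA.
apply: (@pres_trans _ _ _ ([:: (x, b)] ++ [::] ++ [:: (x, ~~ b)])).
  apply: pres_cat; first exact: pres_refl.
  by apply: pres_cat; [exact: IHw | exact: pres_refl].
exact: pres_cancel.
Qed.

Lemma inv_wordVl w : cong (inv_word w ++ w) [::].
Proof. by rewrite -{2}[w]inv_wordK; exact: inv_wordVr. Qed.

Fact pres_mulA : associative pres_mul.
Proof.
move=> f g h; rewrite -[f]pres_reprK -[g]pres_reprK -[h]pres_reprK.
by rewrite !pres_piM catA.
Qed.

Fact pres_mul1 : left_id pres_one pres_mul.
Proof. by move=> g; rewrite -[g]pres_reprK pres_piM. Qed.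

Fact pres_1mul : right_id pres_one pres_mul.
Proof. by move=> g; rewrite -[g]pres_reprK pres_piM cats0. Qed.

Fact pres_mulV : left_inverse pres_one pres_inv pres_mul.
Proof.
move=> g; rewrite -{2}[g]pres_reprK pres_piM.
by apply/pres_piP; exact: inv_wordVl.
Qed.

Fact pres_Vmul : right_inverse pres_one pres_inv pres_mul.
Proof.
move=> g; rewrite -{1}[g]pres_reprK pres_piM.
by apply/pres_piP; exact: inv_wordVr.
Qed.

HB.instance Definition _ := isGroup.Build presented_group
  pres_mulA pres_mul1 pres_1mul pres_mulV pres_Vmul.

Variables (H : groupType) (f : X -> H).

Definition eval_letter (l : X * bool) : H :=
  if l.2 then ((f l.1)^-1)%g else f l.1.

Definition eval_word (w : word X) : H := (\prod_(l <- w) eval_letter l)%g.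

Hypothesis f_rel : forall u v, rel u v -> eval_word u = eval_word v.

Lemma eval_word_cat u v : eval_word (u ++ v) = (eval_word u * eval_word v)%g.
Proof. exact: big_cat. Qed.

Lemma eval_word_cong u v : cong u v -> eval_word u = eval_word v.
Proof.
elim=> {u v} [//|u v _ -> //|u v w _ -> _ -> //|u u' v v' _ uu' _ vv'|x b|//].
  by rewrite !eval_word_cat uu' vv'.
rewrite /eval_word !big_cons !big_nil !mulg1 /eval_letter /=.
by case: b; rewrite /= ?mulVg ?mulgV.
Qed.

Lemma pres_lift : exists h : {multiplicative presented_group -> H},
  forall x, h (pres_gen x) = f x.
Proof.
pose h (g : presented_group) := eval_word (pres_repr g).
have hM : {morph h : x y / (x * y)%g}.
  by move=> x y; rewrite /h (eval_word_cong (pres_repr_pi _)) eval_word_cat.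
exists (HB.pack_for {multiplicative presented_group -> H} h
  (isMultiplicative.Build _ _ h hM)) => x /=.
rewrite /h (eval_word_cong (pres_repr_pi _)).
by rewrite /eval_word big_seq1.
Qed.

End PresentedGroup.

(* Indices are 0-based: j : 'I_n encodes sigma_(j+1), and ordS is the cyclic
   successor, so ordS (n-1) = 0. *)
Inductive necklace_gen (n : nat) := Sigma of 'I_n | Tau.

Section NecklaceGen.
Variable n : nat.
Definition necklace_gen_code (x : necklace_gen n) : option 'I_n :=
  if x is Sigma i then Some i else None.
Definition necklace_gen_decode (o : option 'I_n) : necklace_gen n :=
  if o is Some i then Sigma i else Tau n.
Fact necklace_gen_codeK : cancel necklace_gen_code necklace_gen_decode.
Proof. by case. Qed.
HB.instance Definition _ := Choice.copy (necklace_gen n)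
  (can_type necklace_gen_codeK).
End NecklaceGen.

Section Necklace.
Variable n : nat.
Local Notation s i := (@Sigma n i, false).
Local Notation t := (Tau n, false).
Local Notation tV := (Tau n, true).

Inductive necklace_rel :
    word (necklace_gen n) -> word (necklace_gen n) -> Prop :=
| necklace_braid i :
    necklace_rel [:: s i; s (ordS i); s i] [:: s (ordS i); s i; s (ordS i)]
| necklace_comm i j : i != ordS j -> j != ordS i ->
    necklace_rel [:: s i; s j] [:: s j; s i]
| necklace_conj i : necklace_rel [:: t; s i; tV] [:: s (ordS i)]
| necklace_tau : necklace_rel (nseq (2 * n) t) [::].

Definition necklace_braid_group : groupType := presented_group necklace_rel.
Definition nb_sigma (i : 'I_n) : necklace_braid_group :=
  pres_gen necklace_rel (Sigma i).
Definition nb_tau : necklace_braid_group := pres_gen necklace_rel (Tau n).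

End Necklace.

Section GL.
Variables (n : nat) (F : fieldType).

Record GL := MkGL { GLmx :> 'M[F]_n; GLmx_unit : GLmx \in unitmx }.
HB.instance Definition _ := [isSub for GLmx].
HB.instance Definition _ := [Choice of GL by <:].

Fact GL_mul_unit (A B : GL) : GLmx A *m GLmx B \in unitmx.
Proof. by rewrite unitmx_mul !GLmx_unit. Qed.
Fact GL_inv_unit (A : GL) : invmx A \in unitmx.
Proof. by rewrite unitmx_inv GLmx_unit. Qed.

Definition GL_one := MkGL (unitmx1 F n).
Definition GL_mul (A B : GL) := MkGL (GL_mul_unit A B).
Definition GL_inv (A : GL) := MkGL (GL_inv_unit A).

Fact GL_mulA : associative GL_mul.
Proof. by move=> A B D; apply: val_inj; rewrite /= mulmxA. Qed.
Fact GL_mul1 : left_id GL_one GL_mul.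
Proof. by move=> A; apply: val_inj; rewrite /= mul1mx. Qed.
Fact GL_1mul : right_id GL_one GL_mul.
Proof. by move=> A; apply: val_inj; rewrite /= mulmx1. Qed.
Fact GL_mulV : left_inverse GL_one GL_inv GL_mul.
Proof. by move=> A; apply: val_inj; rewrite /= mulVmx ?GLmx_unit. Qed.
Fact GL_Vmul : right_inverse GL_one GL_inv GL_mul.
Proof. by move=> A; apply: val_inj; rewrite /= mulmxV ?GLmx_unit. Qed.

HB.instance Definition _ :=
  isGroup.Build GL GL_mulA GL_mul1 GL_1mul GL_mulV GL_Vmul.

End GL.

(* Matrices act on column vectors: the subspace of F^n spanned by the
   transposed rows of U is invariant under A iff U is stable under the right
   action of A^T. *)
Definition irreducible_rep (G : groupType) (F : fieldType) (n : nat)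
    (rho : {multiplicative G -> GL n F}) : Prop :=
  (0 < n)%N /\
  forall U : 'M[F]_n,
    (forall g : G, stablemx U (GLmx (rho g))^T) -> U != 0 -> row_full U.

Definition mx2 (F : nzRingType) (a b c d : F) : 'M[F]_2 :=
  \matrix_(i, j) if i == 0 then (if j == 0 then a else b)
                 else (if j == 0 then c else d).

Definition is_necklace_rep (n : nat) (F : fieldType) (T t a c d : F)
    (rho : {multiplicative necklace_braid_group n -> GL 2 F}) : Prop :=
  GLmx (rho (nb_tau n)) = mx2 (T * t) 0 0 t /\
  forall j : 'I_n, GLmx (rho (nb_sigma j)) = mx2 a (T ^+ j) (c * T ^- j) d.

Definition hermitian_posdef (C : numClosedFieldType) (n : nat) (M : 'M[C]_n) :
    Prop :=
  M \is hermsymmx /\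
  forall v : 'cV[C]_n, v != 0 -> 0 < (v ^t* *m M *m v) 0 0.

Definition unitary_relative (C : numClosedFieldType) (n : nat)
    (M A : 'M[C]_n) : Prop :=
  A *m M *m A ^t* = M.

Definition unitary_rep (C : numClosedFieldType) (G : groupType) (n : nat)
    (M : 'M[C]_n) (rho : {multiplicative G -> GL n C}) : Prop :=
  forall g : G, unitary_relative M (GLmx (rho g)).

(* For a = d, c = - d^2, t^8 = 1 and T^2 = -1, the assignment of is_necklace_rep
   does extend to a representation, which is irreducible. *)
Section Consistency.
Variables (C : numClosedFieldType) (T t d : C).
Hypotheses (ht : t ^+ 8 = 1) (hT : T ^+ 2 = -1) (hd : d != 0).

Lemma mx2M (a b c e a' b' c' e' : C) :
  mx2 a b c e *m mx2 a' b' c' e' =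
  mx2 (a * a' + b * c') (a * b' + b * e') (c * a' + e * c') (c * b' + e * e').
Proof.
apply/matrixP => i j; rewrite !mxE !big_ord_recl big_ord0 !mxE /= addr0.
by case: (i == 0); case: (j == 0).
Qed.

Lemma mx2_1 : 1%:M = mx2 1 0 0 1 :> 'M[C]_2.
Proof.
by apply/matrixP => -[[|[|i]] // hi] [[|[|j]] // hj]; rewrite !mxE.
Qed.

Lemma det_mx2 (a b c e : C) : \det (mx2 a b c e) = a * e - b * c.
Proof.
rewrite (expand_det_row _ ord0) !big_ord_recl big_ord0 /cofactor !det_mx11.
by rewrite !mxE /= addr0 expr0 expr1 mul1r mulN1r mulrN.
Qed.

Lemma t_neq0 : t != 0.
Proof. by apply: contra_eq_neq ht => ->; rewrite expr0n eq_sym oner_eq0. Qed.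

Lemma T_neq0 : T != 0.
Proof.
by apply: contra_eq_neq hT => ->; rewrite expr0n eq_sym oppr_eq0 oner_eq0.
Qed.

Lemma T_exp4 : T ^+ 4 = 1.
Proof. by rewrite (exprM T 2 2) hT sqrrN expr1n. Qed.

Lemma tau_unit : mx2 (T * t) 0 0 t \in unitmx.
Proof.
by rewrite unitmxE det_mx2 mulr0 subr0 unitfE !mulf_neq0 ?t_neq0 ?T_neq0.
Qed.

Lemma sigma_unit (j : 'I_4) :
  mx2 d (T ^+ j) (- d ^+ 2 * T ^- j) d \in unitmx.
Proof.
rewrite unitmxE det_mx2 unitfE mulrCA divff ?expf_neq0 ?T_neq0 //.
by rewrite mulr1 opprK -expr2 -mulr2n mulrn_eq0 /= expf_neq0.
Qed.

Definition rep_gen (x : necklace_gen 4) : GL 2 C :=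
  if x is Sigma j then MkGL (sigma_unit j) else MkGL tau_unit.

Lemma T_ordS (j : 'I_4) : T ^+ (ordS j) = T * T ^+ j.
Proof. by rewrite /= (expr_mod _ T_exp4) exprS. Qed.

Lemma rep_gen_rel u v :
  necklace_rel u v -> eval_word rep_gen u = eval_word rep_gen v.
Proof.
have TT : T * T = -1 by rewrite -expr2.
have XY (i : 'I_4) : T ^+ i * T ^- i = 1 by rewrite divff ?expf_neq0 ?T_neq0.
have TV : T^-1 = - T.
  by apply: (mulfI T_neq0); rewrite divff ?T_neq0 // mulrN TT opprK.
case=> [i|i j ij ji|i|]; rewrite /eval_word.
- rewrite !big_cons !big_nil !mulg1 /eval_letter /=; apply: val_inj.
  rewrite /= -/(ordS i) T_ordS invfM TV !mx2M.
  by move: (XY i) => {}XY; congr (mx2 _ _ _ _); ring: TT XY.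
- rewrite !big_cons !big_nil !mulg1 /eval_letter /=; apply: val_inj.
  rewrite /= !mx2M.
  suff [->|->] : T ^+ i = T ^+ j \/ T ^+ i = - T ^+ j.
  - by [].
  - by rewrite invrN; congr (mx2 _ _ _ _); ring.
  case: i ij ji => -[|[|[|[|i]]]] // hi; case: j => -[|[|[|[|j]]]] // hj _ _;
    rewrite ?expr0 ?expr1 ?hT ?exprS ?TT; by [left | right; rewrite ?opprK //; ring: TT].
- rewrite !big_cons !big_nil !mulg1 /eval_letter /=.
  apply: (mulIg (rep_gen (Tau 4))); rewrite -!mulgA mulVg mulg1.
  apply: val_inj; rewrite /= -/(ordS i) T_ordS invfM TV !mx2M.
  by congr (mx2 _ _ _ _); ring: TT.
- rewrite big_nil; apply: val_inj.
  have E k : GLmx (\prod_(l <- nseq k (Tau 4, false)) eval_letter rep_gen l)%g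
            = mx2 ((T * t) ^+ k) 0 0 (t ^+ k).
    elim: k => [|k IHk]; first by rewrite big_nil /= mx2_1 !expr0.
    rewrite /= big_cons /= IHk mx2M !exprS.
    by congr (mx2 _ _ _ _); ring.
  rewrite [LHS]E [RHS]mx2_1.
  by rewrite exprMn ht (exprM T 4 2) T_exp4 expr1n mulr1.
Qed.

Lemma necklace_rep_irreducible
    (rho : {multiplicative necklace_braid_group 4 -> GL 2 C}) :
  is_necklace_rep T t d (- d ^+ 2) d rho -> irreducible_rep rho.
Proof.
case=> tauE sigmaE; split=> // U Ustable U_neq0.
apply/row_fullP; apply: contrapT => U_notfull.
have detU : \det U = 0.
  apply: contrapT => /eqP detU; apply: U_notfull.
  by exists (invmx U); rewrite mulVmx // unitmxE unitfE.
have rows_dep (v w : 'rV[C]_2) : (v <= U)%MS -> (w <= U)%MS ->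
    v 0 0 * w 0 1 = v 0 1 * w 0 0.
  move=> vU wU; pose W := mx2 (v 0 0) (v 0 1) (w 0 0) (w 0 1).
  have /submxP[D WE] : (W <= U)%MS.
    apply/row_subP => i; suff -> : row i W = if i == 0 then v else w.
      by case: ifP.
    apply/rowP => j; rewrite !mxE; case: (i == 0);
      case: j => -[|[|j]] // hj; rewrite /=; congr (_ _ _); exact: val_inj.
  have : \det W = 0 by rewrite WE det_mulmx detU mulr0.
  by rewrite det_mx2 => /eqP; rewrite subr_eq0 => /eqP.
have [i rowU] : exists i, row i U != 0.
  apply: contrapT => rowU; case/negP: U_neq0; apply/eqP/row_matrixP => i.
  by rewrite row0; apply/eqP; apply: contrapT => rowi; apply: rowU; exists i;
     exact/negP.
set v := row i U in rowU.
have vU : (v <= U)%MS by exact: row_sub.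
have v_stable g : (v *m (GLmx (rho g))^T <= U)%MS.
  exact: submx_trans (submxMr _ vU) (Ustable g).
have := rows_dep _ _ vU (v_stable (nb_tau 4)).
have := rows_dep _ _ vU (v_stable (nb_sigma ord0)).
rewrite tauE sigmaE !mxE !big_ord_recl !big_ord0 !mxE /=.
have L : lift ord0 ord0 = 1 :> 'I_2 by exact: val_inj.
have O : ord0 = 0 :> 'I_2 by exact: val_inj.
rewrite ?L ?O.
rewrite expr0 divr1 !addr0 !mulr0 !add0r.
have vE : v = 0 <-> U i 0 = 0 /\ U i 1 = 0.
  split=> [/rowP v0|[U0 U1]]; first by move: (v0 0) (v0 1); rewrite !mxE.
  apply/rowP => -[[|[|j]] // hj]; rewrite !mxE.
    by rewrite -[RHS]U0; congr (U i _); exact: val_inj.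
  by rewrite -[RHS]U1; congr (U i _); exact: val_inj.
move/eqP: rowU; rewrite vE; move: (U i 0) (U i 1) => x y xy0 e1 e2; apply: xy0.
have T1 : 1 - T != 0.
  rewrite subr_eq0; apply/eqP => T1; move: hT; rewrite -T1 expr1n => /eqP.
  by rewrite -subr_eq0 opprK -mulr2n pnatr_eq0.
have : x * y * (t * (1 - T)) = 0.
  by rewrite mulrBr mulr1 mulrBr -mulrA e2; ring.
move=> /eqP; rewrite !mulf_eq0 (negPf T1) (negPf t_neq0) !orbF => xy.
have {}e1 : y ^+ 2 = - (d * x) ^+ 2.
  have -> : y ^+ 2 = y * (x * d + y * 1) - x * y * d by ring.
  by rewrite -e1; ring.
case/orP: xy => /eqP z0; move: e1; rewrite z0.
  by rewrite mulr0 expr0n oppr0 => /eqP; rewrite expf_eq0 => /eqP.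
rewrite expr0n => /esym /eqP; rewrite oppr_eq0 expf_eq0 /= mulf_eq0 (negPf hd).
by move=> /eqP.
Qed.

Lemma necklace_rep_exists :
  exists rho : {multiplicative necklace_braid_group 4 -> GL 2 C},
    is_necklace_rep T t d (- d ^+ 2) d rho.
Proof.
have [rho rhoE] := pres_lift rep_gen_rel.
by exists rho; split=> [|j]; rewrite rhoE.
Qed.

End Consistency.

(* Main.v *)
Require Import Defs.
From HB Require Import structures.
From mathcomp Require Import all_boot all_order all_algebra.
From mathcomp Require Import boolp reals complex.
From mathcomp Require Import ring.

Import Order.TTheory GRing.Theory Num.Theory.

Local Open Scope ring_scope.

(* Invariance of the form [M] under [tau], whose eigenvalues are distinct and of
   modulus 1, forces [M] to be diagonal, [M = diag(p, q)]. Invariance under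
   [sigma_1] then amounts to [q = |d|^2 p] and [|d|^2 p + q = p], i.e. to
   [2 |d|^2 = 1]; conversely [diag(2, 1)] is preserved by all the generators. *)

(** The image of the unit is idempotent, and a group has only one idempotent. *)
Lemma multiplicative1 (G H : groupType) (f : {multiplicative G -> H}) :
  f 1%g = 1%g.
Proof. by apply: (mulgI (f 1%g)); rewrite -gmulfM !mulg1. Qed.

Lemma multiplicativeV (G H : groupType) (f : {multiplicative G -> H}) :
  {morph f : x / (x^-1)%g}.
Proof.
by move=> x; apply: (mulIg (f x)); rewrite -gmulfM !mulVg multiplicative1.
Qed.

(** * The group of matrices preserving a form *)

Section UnitaryRelative.
Local Open Scope sesquilinear_scope.
Variables (C : numClosedFieldType) (n : nat) (M : 'M[C]_n).

Lemma unitary_relative1 : unitary_relative M 1%:M.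
Proof. by rewrite /unitary_relative mul1mx trmx1 map_mx1 mulmx1. Qed.

Lemma unitary_relativeM (A B : 'M[C]_n) :
  unitary_relative M A -> unitary_relative M B -> unitary_relative M (A *m B).
Proof.
rewrite /unitary_relative => AM BM.
by rewrite trmx_mul map_mxM -[RHS]AM -[in RHS]BM !mulmxA.
Qed.

Lemma unitary_relativeV (A : 'M[C]_n) :
  A \in unitmx -> unitary_relative M A -> unitary_relative M (invmx A).
Proof.
rewrite /unitary_relative => Au AM.
rewrite -[in LHS]AM !mulmxA mulVmx // mul1mx -mulmxA -map_mxM -trmx_mul.
by rewrite mulVmx // trmx1 map_mx1 mulmx1.
Qed.

(** Matrices unitary relative to [M] are closed under products and inverses, so induction on a word
    representing [g] reduces the claim to single letters. *)
Lemma unitary_rep_gen (X : choiceType) (rel : word X -> word X -> Prop)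
    (rho : {multiplicative presented_group rel -> GL n C}) :
  (forall x, unitary_relative M (GLmx (rho (pres_gen rel x)))) ->
  unitary_rep M rho.
Proof.
move=> gens g; rewrite -[g]pres_reprK.
elim: (pres_repr g) => [|[x b] w IHw].
  have -> : pres_pi rel [::] = 1%g by [].
  by rewrite multiplicative1; exact: unitary_relative1.
have -> : pres_pi rel ((x, b) :: w) = (pres_pi rel [:: (x, b)] * pres_pi rel w)%g.
  by rewrite [RHS]pres_piM.
rewrite gmulfM; apply: unitary_relativeM => //.
case: b; last exact: gens.
(* The cancellation rule of [pres_cong] makes the class of a formal inverse letter a genuine
   inverse. *)
have -> : pres_pi rel [:: (x, true)] = (pres_gen rel x)^-1%g.
  apply: (mulIg (pres_gen rel x)); rewrite mulVg [LHS]pres_piM.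
  by apply/pres_piP; exact: (pres_cancel rel x true).
by rewrite multiplicativeV; apply: unitary_relativeV; [exact: GLmx_unit | exact: gens].
Qed.

End UnitaryRelative.

(** * Invariant hermitian forms in dimension two *)

Section TwoByTwo.
Local Open Scope sesquilinear_scope.
Variable C : numClosedFieldType.
Implicit Types (a b c e p q t T d : C) (M : 'M[C]_2).

Lemma mx2E M : M = mx2 (M 0 0) (M 0 1) (M 1 0) (M 1 1).
Proof.
by apply/matrixP => -[[|[|i]] // hi] [[|[|j]] // hj]; rewrite !mxE /=;
  congr (M _ _); exact: val_inj.
Qed.

Lemma mx2_inj a b c e a' b' c' e' :
  mx2 a b c e = mx2 a' b' c' e' -> [/\ a = a', b = b', c = c' & e = e'].
Proof.
move/matrixP => E.
by split; [move: (E 0 0) | move: (E 0 1) | move: (E 1 0) | move: (E 1 1)];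
  rewrite !mxE.
Qed.

Lemma mx2_adj a b c e : (mx2 a b c e) ^t* = mx2 a^* c^* b^* e^*.
Proof.
by apply/matrixP => i j; rewrite !mxE; case: (i == 0); case: (j == 0).
Qed.

(** The form takes the value [M i i] at the [i]-th standard basis vector. *)
Lemma hermitian_posdef_diag_gt0 n (M : 'M[C]_n) i :
  hermitian_posdef M -> 0 < M i i.
Proof.
case=> _ /(_ (delta_mx i 0)).
rewrite trmx_delta map_delta_mx -rowE -colE !mxE; apply.
apply/eqP => /matrixP/(_ i 0); rewrite !mxE !eqxx => /eqP.
by rewrite oner_eq0.
Qed.

Lemma hermitian_posdef_mx2 p q :
  0 < p -> 0 < q -> hermitian_posdef (mx2 p 0 0 q).
Proof.
move=> p0 q0; split.
  apply/is_hermitianmxP; rewrite expr0 scale1r mx2_adj !conjC0.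
  by rewrite !conj_Creal // gtr0_real.
move=> v v0; rewrite -mulmxA !mxE !big_ord_recl big_ord0 !mxE.
rewrite !big_ord_recl !big_ord0 !mxE /= !mul0r !addr0 add0r.
rewrite [_^* * (p * _)]mulrCA -normCKC [_^* * _]mulrCA -normCKC.
(* The form is now p |v_0|^2 + q |v_1|^2. Its first term is already positive unless v_0 = 0, and
   then v_1 cannot vanish. *)
have [v00|v00] := eqVneq (v ord0 0) 0; last first.
  by rewrite ltr_wpDr ?mulr_gt0 ?exprn_gt0 ?normr_gt0 // mulr_ge0 ?exprn_ge0 // ltW.
rewrite v00 normr0 expr0n mulr0 add0r mulr_gt0 // exprn_gt0 // normr_gt0.
apply: contra_neq v0 => v10; apply/matrixP => i j; rewrite mxE (ord1 j).
by case: (unliftP ord0 i) => [k|] -> //; rewrite (ord1 k).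
Qed.

Lemma norm_unity_root t k : (0 < k)%N -> t ^+ k = 1 -> `|t| = 1.
Proof.
by move=> k0 tk; apply/eqP; rewrite -(pexpr_eq1 k0) // -normrX tk normr1.
Qed.

(** Since t t^* = 1, the transformation multiplies the off-diagonal entries of [M] by T and T^*,
    both different from 1. *)
Lemma unitary_tau_diag M T t : `|t| = 1 -> T != 1 ->
  unitary_relative M (mx2 (T * t) 0 0 t) -> M = mx2 (M 0 0) 0 0 (M 1 1).
Proof.
move=> t1 T1; have tt : t * t^* = 1 by rewrite -normCK t1 expr1n.
rewrite /unitary_relative [M in LHS]mx2E [M in RHS]mx2E mx2_adj !mx2M.
case/mx2_inj; rewrite !conjC0 !(mulr0, mul0r, addr0, add0r) => _ e1 e2 _.
rewrite {1}[M]mx2E; congr (mx2 _ _ _ _).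
  apply/eqP; move/eqP: e1; rewrite -subr_eq0.
  have -> : T * t * M 0 1 * t^* - M 0 1 = (T - 1) * M 0 1 by ring: tt.
  by rewrite mulf_eq0 subr_eq0 (negPf T1).
apply/eqP; move/eqP: e2; rewrite -subr_eq0 rmorphM.
have -> : t * M 1 0 * (T^* * t^*) - M 1 0 = (T - 1)^* * M 1 0.
  by rewrite rmorphB rmorph1; ring: tt.
by rewrite mulf_eq0 conjC_eq0 subr_eq0 (negPf T1).
Qed.

Lemma unitary_tau p q T t : `|t| = 1 -> `|T| = 1 ->
  unitary_relative (mx2 p 0 0 q) (mx2 (T * t) 0 0 t).
Proof.
move=> t1 T1; have tt : t * t^* = 1 by rewrite -normCK t1 expr1n.
have TT : T * T^* = 1 by rewrite -normCK T1 expr1n.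
rewrite /unitary_relative mx2_adj !mx2M !conjC0 rmorphM.
by congr (mx2 _ _ _ _); ring: tt TT.
Qed.

Lemma unitary_sigma_norm p q d : p != 0 -> d != 0 ->
  unitary_relative (mx2 p 0 0 q) (mx2 d 1 (- d ^+ 2) d) -> `|d| ^+ 2 = 2^-1.
Proof.
move=> p0 d0; rewrite /unitary_relative mx2_adj !mx2M rmorphN rmorphXn rmorph1.
case/mx2_inj => /= e1 e2 _ _.
(* The off-diagonal equation [e2] reads d^* (q - d d^* p) = 0. *)
have {}e2 : q = d * d^* * p.
  apply: (mulIf (x := d^*)); first by rewrite conjC_eq0.
  by apply/eqP; rewrite -subr_eq0 -[X in _ == X]e2; apply/eqP; ring.
(* Once q is eliminated, [e1] becomes 2 d d^* p = p. *)
apply: (mulfI (x := 2 * p)); first by rewrite mulf_neq0 ?pnatr_eq0.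
rewrite normCK [RHS]mulrAC divff ?pnatr_eq0 // mul1r -[RHS]e1 e2; ring.
Qed.

(** Here u stands for a power of T. The hypotheses turn conjugates into inverses, d^* = (2 d)^-1 and
    u^* = u^-1, which leaves identities between rational functions of d and u. *)
Lemma unitary_sigma d u : `|u| = 1 -> `|d| ^+ 2 = 2^-1 ->
  unitary_relative (mx2 2 0 0 1) (mx2 d u (- d ^+ 2 * u^-1) d).
Proof.
move=> u1 dd; have d0 : d != 0.
  by apply: contra_eq_neq dd => ->; rewrite normr0 expr0n eq_sym invr_eq0 pnatr_eq0.
have u0 : u != 0 by rewrite -normr_eq0 u1 oner_eq0.
have dC : d^* = (2 * d)^-1.
  by rewrite invfM -dd normCK mulrC mulrA mulVf // mul1r.
have uC : u^* = u^-1 by rewrite invC_norm u1 expr1n invr1 mul1r.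
(* Writing u^-1 as u^* first lets [conjCK] turn its conjugate back into u. *)
rewrite /unitary_relative mx2_adj !mx2M -uC rmorphM rmorphN rmorphXn /= conjCK.
by rewrite uC dC; congr (mx2 _ _ _ _); field; rewrite ?d0 ?u0 ?pnatr_eq0.
Qed.

End TwoByTwo.

Theorem proposition4p3 (R : realType) (T t a c d : R[i])
    (ht : t ^+ 8 = 1) (hT : T = 'i \/ T = - 'i) (hd : d != 0)
    (ha : a = d) (hc : c = - d ^+ 2)
    (rho : {multiplicative necklace_braid_group 4 -> GL 2 R[i]})
    (hrho : is_necklace_rep T t a c d rho)
    (hirr : irreducible_rep rho) :
  (exists M : 'M[R[i]]_2, hermitian_posdef M /\ unitary_rep M rho) <->
  `|d| ^+ 2 = 2^-1.
Proof.
have t1 : `|t| = 1 by exact: norm_unity_root ht.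
have T2 : T ^+ 2 = -1 by case: hT => ->; rewrite ?sqrrN sqrCi.
have T1 : `|T| = 1.
  by apply: (@norm_unity_root _ _ 4) => //; rewrite (exprM T 2 2) T2 sqrrN expr1n.
have Tn1 : T != 1.
  apply/eqP => Te; move: T2; rewrite Te expr1n => /eqP.
  by rewrite -subr_eq0 opprK -mulr2n pnatr_eq0.
case: hrho => tauE sigmaE; rewrite {}ha {}hc in sigmaE; split.
  case=> M [Mpos Mrho].
  have := Mrho (nb_tau 4); rewrite tauE => /(unitary_tau_diag _ _ _ _ t1 Tn1) ME.
  (* At index 0 the power of T is 1, which gives the matrix of [unitary_sigma_norm]. *)
  have := Mrho (nb_sigma ord0); rewrite sigmaE expr0 invr1 mulr1 ME.
  by apply: unitary_sigma_norm => //; exact/lt0r_neq0/hermitian_posdef_diag_gt0.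
(* The relation q = |d|^2 p with |d|^2 = 1/2 fixes diag(p, q) up to scale; take q = 1. *)
move=> dd; exists (mx2 2 0 0 1); split; first exact: hermitian_posdef_mx2.
apply: unitary_rep_gen => -[j|].
  rewrite [GLmx _]sigmaE; apply: unitary_sigma => //.
  by rewrite normrX T1 expr1n.
by rewrite [GLmx _]tauE; exact: unitary_tau.
Qed.
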